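(* The semigroup $S$ given by the semigroup presentation $$S = \langle a,b,c,e,x \mid axb = acx,\ ac = ca,\ xca = xe,\ ea = ae,\ aex = ax,\ xexb = bxex \rangle$$ is LWF (locally wrapped by the class of finite semigroups).
   Context: Maps are written on the right. A semigroup $S$ is called LWF if for every finite subset $H$ of $S$ there exist a finite semigroup $D_H$ and a function $d_H: D_H\to S$ such that $H\subseteq D_Hd_H$ and for all $x',y'\in D_H$ with $x'd_H, y'd_H\in H$ we have $(x'y')d_H = (x'd_H)(y'd_H)$. The presentation is a semigroup presentation: $S$ is the quotient of the free semigroup (nonempty words) on the generators by the congruence generated by the relations; the generator $e$ is not assumed to be idempotent or an identity. *)

(* Defs.v *)
From HB Require Import structures.
From mathcomp Require Import all_boot generic_quotient finmap boolp.

Set Implicit Arguments.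
Unset Strict Implicit.
Unset Printing Implicit Defensive.

Local Open Scope quotient_scope.
Local Open Scope group_scope.

#[short(type="finSemigroupType")]
HB.structure Definition FinSemigroup := {G of Semigroup G & Finite G}.

(* LWF = locally wrapped by the class of finite semigroups.  The map [d] need
   not be a morphism: it is multiplicative only on pairs whose images both lie
   in [H]. *)
Definition LWF (S : semigroupType) : Prop :=
  forall H : {fset S}, exists (D : finSemigroupType) (d : D -> S),
    (forall h : S, h \in H -> exists x : D, d x = h) /\
    (forall x y : D, d x \in H -> d y \in H -> d (x * y) = d x * d y).

Record freeSemigroup (A : choiceType) :=
  Word { letters :> seq A; _ : letters != [::] }.

HB.instance Definition _ (A : choiceType) := [isSub for @letters A].
HB.instance Definition _ (A : choiceType) :=
  [Choice of freeSemigroup A by <:].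

Lemma cat_neq_nil (A : choiceType) (u v : freeSemigroup A) :
  letters u ++ letters v != [::].
Proof. by case: u => -[]. Qed.

Definition free_mul (A : choiceType) (u v : freeSemigroup A) :=
  Word (cat_neq_nil u v).

Lemma free_mulA (A : choiceType) : associative (@free_mul A).
Proof. by move=> u v w; apply/val_inj; rewrite /= catA. Qed.

HB.instance Definition _ (A : choiceType) :=
  isSemigroup.Build (freeSemigroup A) (@free_mulA A).

Definition letter (A : choiceType) (g : A) : freeSemigroup A :=
  @Word A [:: g] isT.

Inductive gen_cong (G : semigroupType) (R : seq (G * G)) : G -> G -> Prop :=
| gen_cong_base u v : (u, v) \in R -> gen_cong R u v
| gen_cong_refl u : gen_cong R u u
| gen_cong_sym u v : gen_cong R u v -> gen_cong R v u
| gen_cong_trans v u w : gen_cong R u v -> gen_cong R v w -> gen_cong R u w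
| gen_cong_mull w u v : gen_cong R u v -> gen_cong R (w * u) (w * v)
| gen_cong_mulr w u v : gen_cong R u v -> gen_cong R (u * w) (v * w).

(* The generated congruence need not be decidable; classical logic turns it
   into the boolean relation that [{eq_quot _}] expects. *)
Definition gen_congb (G : semigroupType) (R : seq (G * G)) : rel G :=
  fun u v => `[< gen_cong R u v >].

Lemma gen_congb_refl (G : semigroupType) (R : seq (G * G)) :
  reflexive (gen_congb R).
Proof. by move=> u; apply/asboolP/gen_cong_refl. Qed.

Lemma gen_congb_sym (G : semigroupType) (R : seq (G * G)) :
  symmetric (gen_congb R).
Proof. by move=> u v; apply/asboolP/asboolP; apply: gen_cong_sym. Qed.

Lemma gen_congb_trans (G : semigroupType) (R : seq (G * G)) :
  transitive (gen_congb R).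
Proof.
by move=> v u w /asboolP uv /asboolP vw; apply/asboolP/(gen_cong_trans uv vw).
Qed.

Canonical gen_cong_equiv (G : semigroupType) (R : seq (G * G)) :=
  EquivRel (gen_congb R) (gen_congb_refl R) (gen_congb_sym R)
    (@gen_congb_trans G R).

Definition presented (A : choiceType)
    (R : seq (freeSemigroup A * freeSemigroup A)) : Type :=
  {eq_quot gen_congb R}.

HB.instance Definition _ (A : choiceType)
    (R : seq (freeSemigroup A * freeSemigroup A)) :=
  EqQuotient.on (presented R).
HB.instance Definition _ (A : choiceType)
    (R : seq (freeSemigroup A * freeSemigroup A)) :=
  Choice.on (presented R).

Definition presented_mul (A : choiceType)
    (R : seq (freeSemigroup A * freeSemigroup A)) :
  presented R -> presented R -> presented R :=
  lift_op2 (presented R) *%g.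

Lemma presented_eqP (A : choiceType)
    (R : seq (freeSemigroup A * freeSemigroup A)) (u v : freeSemigroup A) :
  \pi_(presented R) u = \pi_(presented R) v <-> gen_cong R u v.
Proof.
by split=> [/eqmodP/asboolP //|uv]; apply/eqmodP/asboolP.
Qed.

Lemma presented_pi_mul (A : choiceType)
    (R : seq (freeSemigroup A * freeSemigroup A)) (u v : freeSemigroup A) :
  \pi_(presented R) (u * v) =
  presented_mul (\pi_(presented R) u) (\pi_(presented R) v).
Proof.
rewrite /presented_mul -lock; apply/presented_eqP.
apply: (@gen_cong_trans _ _ (u * repr (\pi_(presented R) v))).
  by apply/gen_cong_mull/presented_eqP; rewrite reprK.
by apply/gen_cong_mulr/presented_eqP; rewrite reprK.
Qed.

Lemma presented_mulA (A : choiceType)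
    (R : seq (freeSemigroup A * freeSemigroup A)) :
  associative (@presented_mul A R).
Proof.
elim/quotW=> u; elim/quotW=> v; elim/quotW=> w.
by rewrite -!presented_pi_mul mulgA.
Qed.

HB.instance Definition _ (A : choiceType)
    (R : seq (freeSemigroup A * freeSemigroup A)) :=
  isSemigroup.Build (presented R) (@presented_mulA A R).

Inductive generator := gen_a | gen_b | gen_c | gen_e | gen_x.

Definition gen_code (g : generator) : 'I_5 :=
  match g with
  | gen_a => @Ordinal 5 0 isT
  | gen_b => @Ordinal 5 1 isT
  | gen_c => @Ordinal 5 2 isT
  | gen_e => @Ordinal 5 3 isT
  | gen_x => @Ordinal 5 4 isT
  end.

Definition gen_decode (i : 'I_5) : generator :=
  nth gen_a [:: gen_a; gen_b; gen_c; gen_e; gen_x] i.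

Lemma gen_codeK : cancel gen_code gen_decode.
Proof. by case. Qed.

HB.instance Definition _ := Finite.copy generator (can_type gen_codeK).

Definition S_rels : seq (freeSemigroup generator * freeSemigroup generator) :=
  let a := letter gen_a in let b := letter gen_b in let c := letter gen_c in
  let e := letter gen_e in let x := letter gen_x in
  [:: (a * x * b, a * c * x);
      (a * c, c * a);
      (x * c * a, x * e);
      (e * a, a * e);
      (a * e * x, a * x);
      (x * e * x * b, b * x * e * x)].

Definition S_pres : semigroupType := presented S_rels.

(* Main.v *)
(** To wrap a finite [H], it suffices to find a set of "good" words evaluating
    into [H], closed under those products that stay in [H], and a finite-index
    congruence on words whose classes meet (good or good * good) in words with
    a single value.

    Each of the following depends only on the class of a word: the number of
    [x]'s; #a - #b - #c; the number of [a]'s before the first [x]; the number of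
    [a]'s and [e]'s after the last [x].  So for words with value in [H] only the
    [a]'s lying between two [x]'s can be numerous, as in x a^(i+1) x b^i = xax.
    When two words are multiplied, the new inner block is made of the outer
    blocks of the factors, so a bound on the inner [a]'s is preserved, and it
    bounds every letter except [e].

    The [e]'s are controlled by one more invariant, which counts the leading
    [e]'s unless they are absorbed by a later "a ... x": if e^j q has value in
    [H] and [j] is large, then eq = q.  Hence, with all long runs of [e]
    truncated at a common length [M], words whose number of letters other than
    [e] is bounded have finitely many classes, and the product of two good words
    keeps its value under truncation. *)
From HB Require Import structures.
From mathcomp Require Import all_boot generic_quotient finmap boolp.
From mathcomp Require Import zify.
Require Import Defs.

Set Implicit Arguments.
Unset Strict Implicit.
Unset Printing Implicit Defensive.

Local Open Scope quotient_scope.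

(** * Wrapping by a finite quotient of words *)

Lemma LWF_at_of_finite_index (F S : semigroupType) (f : F -> S)
    (Y : finType) (phi : F -> Y) (H : {fset S}) (good : F -> Prop) (s : S) :
  (forall u v, f (u * v)%g = (f u * f v)%g) ->
  (forall u u' v v', phi u = phi u' -> phi v = phi v' ->
     phi (u * v)%g = phi (u' * v')%g) ->
  s \notin H ->
  (forall h, h \in H -> exists2 u, good u & f u = h) ->
  (forall u v, good u -> good v -> f (u * v)%g \in H -> good (u * v)%g) ->
  (forall u v,
     (good u \/ exists u1 u2, [/\ good u1, good u2 & u = (u1 * u2)%g]) ->
     (good v \/ exists v1 v2, [/\ good v1, good v2 & v = (v1 * v2)%g]) ->
     phi u = phi v -> f u = f v) ->
  exists (D : finSemigroupType) (d : D -> S),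
    (forall h : S, h \in H -> exists x : D, d x = h) /\
    (forall x y : D, d x \in H -> d y \in H -> d (x * y)%g = (d x * d y)%g).
Proof.
move=> fM phiM sH Hgood goodM fphi.
pose img (y : Y) := `[< exists u, phi u = y >].
pose D := {y : Y | img y}.
have Drep (y : D) : {u : F | phi u = val y}.
  by apply: cid; apply/asboolP; exact: (valP y).
pose mk u : D := exist _ (phi u) (asboolT (ex_intro _ u erefl)).
pose mul (y z : D) : D := mk (sval (Drep y) * sval (Drep z))%g.
have mulE u v : mul (mk u) (mk v) = mk (u * v)%g.
  by apply/val_inj => /=; apply: phiM; rewrite (svalP (Drep _)).
have mkP (y : D) : exists u, y = mk u.
  by exists (sval (Drep y)); apply/val_inj; rewrite /= (svalP (Drep y)).
have mulA : associative mul.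
  move=> y z t; have [u ->] := mkP y; have [v ->] := mkP z.
  by have [w ->] := mkP t; rewrite !mulE mulgA.
pose dM := isSemigroup.Build D mulA.
pose DT : finSemigroupType := HB.pack D dM.
pose tracked u :=
  good u \/ exists u1 u2, [/\ good u1, good u2 & u = (u1 * u2)%g].
(* Classes without a tracked word go to [s], outside [H], so they never occur as factors in the
   wrapping condition. *)
pose d (y : DT) : S :=
  if pselect (exists u, tracked u /\ mk u = y) is left P then f (sval (cid P))
  else s.
have dE u : tracked u -> d (mk u) = f u.
  move=> tu; rewrite /d; case: pselect => [P|]; last by case; exists u.
  case: (svalP (cid P)) => tv /(congr1 val) /= e.
  exact: fphi.
have dH y : d y \in H -> exists u, [/\ good u, y = mk u & d y = f u].
  rewrite {1}/d; case: pselect => [P|_]; last by rewrite (negbTE sH).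
  case: (svalP (cid P)); set u := sval _ => tu <- fu; exists u.
  split=> //; last exact: dE.
  by case: tu => [//|[u1 [u2 [g1 g2 e]]]]; rewrite e in fu *; apply: goodM.
exists DT, d; split=> [h /Hgood[u gu <-]|
    x y /dH[u [gu -> ->]] /dH[v [gv -> ->]]].
  by exists (mk u); apply: dE; left.
rewrite -fM -dE; last by right; exists u, v.
by congr d; exact: mulE.
Qed.

(** * Consequences of the relations on words *)

Notation word := (seq generator).

(** The first disjunct takes in the empty word, so that contexts and factors may be empty. *)
Definition eqv (u v : word) : Prop :=
  u = v \/ exists U V : freeSemigroup generator,
    [/\ gen_cong S_rels U V, letters U = u & letters V = v].

Lemma eqv_refl u : eqv u u. Proof. by left. Qed.

Lemma eqv_sym u v : eqv u v -> eqv v u.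
Proof.
case=> [->|[U [V [UV <- <-]]]]; first by left.
by right; exists V, U; split=> //; apply: gen_cong_sym.
Qed.

Lemma eqv_trans v u w : eqv u v -> eqv v w -> eqv u w.
Proof.
case=> [->//|[U [V [UV <- <-]]]] [<-|[V' [W [VW e <-]]]]; right.
  by exists U, V.
by exists U, W; split=> //; apply: gen_cong_trans UV _; rewrite -(val_inj e).
Qed.

Lemma eqv_cat2l p u v : eqv u v -> eqv (p ++ u) (p ++ v).
Proof.
case=> [->|[U [V [UV <- <-]]]]; first by left.
case: p => [|g p]; right; first by exists U, V.
pose P := @Word generator (g :: p) isT.
by exists (P * U)%g, (P * V)%g; split=> //; apply: gen_cong_mull.
Qed.

Lemma eqv_cat2r p u v : eqv u v -> eqv (u ++ p) (v ++ p).
Proof.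
case=> [->|[U [V [UV <- <-]]]]; first by left.
case: p => [|g p]; right; first by exists U, V; rewrite !cats0.
pose P := @Word generator (g :: p) isT.
by exists (U * P)%g, (V * P)%g; split=> //; apply: gen_cong_mulr.
Qed.

Lemma eqv_letters (U V : freeSemigroup generator) :
  eqv U V <-> gen_cong S_rels U V.
Proof.
split=> [[/val_inj->|[U' [V' [UV eU eV]]]]|UV]; last by right; exists U, V.
  exact: gen_cong_refl.
by rewrite -(val_inj eU) -(val_inj eV).
Qed.

Lemma eqv_rel (U V : freeSemigroup generator) q :
  (U, V) \in S_rels -> eqv (U ++ q) (V ++ q).
Proof. by move=> UV; apply/eqv_cat2r/eqv_letters/gen_cong_base. Qed.

Definition ace : pred generator := [pred g | g \in [:: gen_a; gen_c; gen_e]].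

Lemma eqv_a_ace u q : all ace u -> eqv (gen_a :: u ++ q) (u ++ gen_a :: q).
Proof.
elim: u => [_|g u IH /= /andP[ag /IH{}IH]]; first exact: eqv_refl.
apply: eqv_trans (eqv_cat2l [:: g] IH).
case: g ag => // _; first exact: eqv_refl.
  exact: (@eqv_rel (letter gen_a * letter gen_c)%g
    (letter gen_c * letter gen_a)%g).
apply: eqv_sym.
exact: (@eqv_rel (letter gen_e * letter gen_a)%g
  (letter gen_a * letter gen_e)%g).
Qed.

Lemma eqv_e_a q : eqv [:: gen_e, gen_a & q] [:: gen_a, gen_e & q].
Proof. by apply/eqv_sym/(@eqv_a_ace [:: gen_e]). Qed.

Lemma eqv_aex q : eqv [:: gen_a, gen_e, gen_x & q] [:: gen_a, gen_x & q].
Proof.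
exact: (@eqv_rel (letter gen_a * letter gen_e * letter gen_x)%g
  (letter gen_a * letter gen_x)%g).
Qed.

Lemma eqv_axb q : eqv [:: gen_a, gen_x, gen_b & q] [:: gen_a, gen_c, gen_x & q].
Proof.
exact: (@eqv_rel (letter gen_a * letter gen_x * letter gen_b)%g
  (letter gen_a * letter gen_c * letter gen_x)%g).
Qed.

Lemma eqv_xexb q :
  eqv [:: gen_x, gen_e, gen_x, gen_b & q] [:: gen_b, gen_x, gen_e, gen_x & q].
Proof.
exact: (@eqv_rel (letter gen_x * letter gen_e * letter gen_x * letter gen_b)%g
  (letter gen_b * letter gen_x * letter gen_e * letter gen_x)%g).
Qed.

(** Induction on the last letter before [x], next to which [a] can be moved: a [c] becomes a [b]
    after [x] by acx = axb, an [e] vanishes by aex = ax, and an [a] is carried to the front, where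
    ea = ae lets the leading [e] pass it. *)
Lemma eqv_absorb_before_x u q : all ace u ->
  eqv [:: gen_e, gen_a & u ++ gen_x :: q] (gen_a :: u ++ gen_x :: q).
Proof.
elim/last_ind: u q => [|u g IH] q.
  by move=> _; apply: eqv_trans (eqv_e_a _) _; apply: eqv_aex.
rewrite all_rcons cat_rcons => /andP[ag au].
have red z : eqv (gen_a :: u ++ g :: gen_x :: q) z ->
    eqv (gen_e :: z) z -> eqv [:: gen_e, gen_a & u ++ g :: gen_x :: q]
      (gen_a :: u ++ g :: gen_x :: q).
  move=> e1 e2; apply: eqv_trans (eqv_cat2l [:: gen_e] e1) _.
  exact: eqv_trans e2 (eqv_sym e1).
case: g ag red => // _ red.
- apply: (red [:: gen_a, gen_a & u ++ gen_x :: q]).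
    by apply: (eqv_cat2l [:: gen_a]); apply/eqv_sym/eqv_a_ace.
  apply: eqv_trans (eqv_e_a _) _.
  by apply: (eqv_cat2l [:: gen_a]); apply: IH.
- apply: (red (gen_a :: u ++ gen_x :: gen_b :: q)); last exact: IH.
  apply: eqv_trans (eqv_a_ace _ au) _.
  apply: eqv_trans (eqv_sym (eqv_a_ace _ au)).
  by apply: eqv_cat2l; apply/eqv_sym/eqv_axb.
- apply: (red (gen_a :: u ++ gen_x :: q)); last exact: IH.
  apply: eqv_trans (eqv_a_ace _ au) _.
  apply: eqv_trans (eqv_sym (eqv_a_ace _ au)).
  by apply: eqv_cat2l; apply: eqv_aex.
Qed.

(** * An invariant counting leading letters [e] *)

(** [(ha, m, r)]: [ha] tells whether the longest prefix over {a, c, e} contains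
    [a]; [m] counts its [e]'s, except that it is 0 when they are absorbed;
    [r] tells whether what follows that prefix lies in xS^1.  The case of [b]
    refers to the class of the word, which makes both sides of xexb = bxex act
    alike. *)
Fixpoint lead_state (w : word) : bool * nat * bool :=
  if w is g :: w' then
    let: (ha, m, r) := lead_state w' in
    match g with
    | gen_a => (true, if r then 0 else m, r)
    | gen_b => (false, 0, `[< exists v, eqv w (gen_x :: v) >])
    | gen_c => (ha, m, r)
    | gen_e => (ha, if ha && r then 0 else m.+1, r)
    | gen_x => (false, 0, true)
    end
  else (false, 0, false).

Lemma lead_state_cat2l p u v :
  eqv u v -> lead_state u = lead_state v ->
  lead_state (p ++ u) = lead_state (p ++ v).
Proof.
move=> uv suv; elim: p => [//|g p /= ->].
case: (lead_state _) => [[ha m] r]; case: g => //.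
congr (_, _, _); apply: asbool_equiv_eq.
have e := eqv_cat2l (gen_b :: p) uv.
split=> -[z]; exists z; first exact: eqv_trans (eqv_sym e) _.
exact: eqv_trans e _.
Qed.

(** The right context [q] belongs to the induction because [lead_state] is computed from the right
    end of the word. *)
Lemma lead_state_cat2r (u v : freeSemigroup generator) q :
  gen_cong S_rels u v -> lead_state (u ++ q) = lead_state (v ++ q).
Proof.
move=> uv; elim: uv q => {u v}
  [u v|//|u v _ IH q|v u w _ IH1 _ IH2 q|w u v uv IH q|w u v uv IH q].
- move=> uv q; move: uv; rewrite !inE.
  case/or4P=> [/eqP[-> ->]|/eqP[-> ->]|/eqP[-> ->]|/or3P[]/eqP[-> ->]] /=.
  + by case: (lead_state q) => [[? ?] ?].
  + by case: (lead_state q) => [[? ?] ?].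
  + by case: (lead_state q) => [[? ?] ?].
  + by case: (lead_state q) => [[[] ?] []].
  + by case: (lead_state q) => [[? ?] ?].
  + case: (lead_state q) => [[? ?] ?]; congr (_, _, _).
    apply/esym/asboolP; exists [:: gen_e, gen_x, gen_b & q].
    exact/eqv_sym/eqv_xexb.
- by rewrite IH.
- by rewrite IH1.
- rewrite /= -!catA; apply: lead_state_cat2l; last exact: IH.
  exact/eqv_cat2r/eqv_letters.
- by rewrite /= -!catA.
Qed.

Lemma lead_state_eqv u v : eqv u v -> lead_state u = lead_state v.
Proof.
case=> [->//|[U [V [UV <- <-]]]].
by have := lead_state_cat2r [::] UV; rewrite !cats0.
Qed.

Lemma lead_state_size w : (lead_state w).1.2 <= size w.
Proof.
elim: w => [//|g w /=].
by case: (lead_state w) => [[[] m] []]; case: g => //=; lia.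
Qed.

Lemma lead_state_nseq_e j q :
  (lead_state (nseq j gen_e ++ q)).1.2 <= j + (lead_state q).1.2.
Proof.
elim: j => [//|j /=]; rewrite -/(cat _ _).
by case: (lead_state _) => [[ha m] r] /=; case: ifP; lia.
Qed.

Lemma lead_state_factor q : (lead_state q).2 -> exists u v,
  [/\ all ace u, eqv q (u ++ gen_x :: v) & (lead_state q).1.1 = (gen_a \in u)].
Proof.
elim: q => [//|g q IH] /=; case: (lead_state q) IH => [[ha m] r] /= IH.
case: g => /=.
- move=> /IH [u [v [au e _]]]; exists (gen_a :: u), v; split=> //.
  exact: (eqv_cat2l [:: gen_a]).
- by move=> /asboolP[v e]; exists [::], v.
- move=> /IH [u [v [au e ->]]]; exists (gen_c :: u), v; split=> //.
  exact: (eqv_cat2l [:: gen_c]).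
- move=> /IH [u [v [au e ->]]]; exists (gen_e :: u), v; split=> //.
  exact: (eqv_cat2l [:: gen_e]).
- by move=> _; exists [::], q; split=> //; apply: eqv_refl.
Qed.

Lemma eqv_absorb q :
  (lead_state q).1.1 -> (lead_state q).2 -> eqv (gen_e :: q) q.
Proof.
move=> ha /lead_state_factor[u [v [au e]]]; rewrite ha => /esym au'.
have [u1 [u2 eu]] : exists u1 u2, u = u1 ++ gen_a :: u2.
  by case/splitPr: au' => u1 u2; exists u1, u2.
move: au; rewrite eu all_cat /= => /andP[au1 au2].
have e' : eqv q (gen_a :: (u1 ++ u2) ++ gen_x :: v).
  apply: eqv_trans e _; rewrite eu -!catA /=.
  exact/eqv_sym/eqv_a_ace.
apply: eqv_trans (eqv_cat2l [:: gen_e] e') _.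
apply: eqv_trans (eqv_sym e').
by apply: eqv_absorb_before_x; rewrite all_cat au1.
Qed.

(** Unless [q] absorbs [e], each leading [e] raises the counter by one, so the counter of [w] would
    be at least [j]. *)
Lemma eqv_absorb_many j q w :
  eqv (nseq j gen_e ++ q) w -> (lead_state w).1.2 < j -> eqv (gen_e :: q) q.
Proof.
move=> /lead_state_eqv <-.
have [/andP[ha r] _|nabs] := boolP ((lead_state q).1.1 && (lead_state q).2).
  exact: eqv_absorb.
suff -> : lead_state (nseq j gen_e ++ q) =
    ((lead_state q).1.1, (lead_state q).1.2 + j, (lead_state q).2).
  by rewrite /=; lia.
elim: j => [|j /= ->]; first by rewrite addn0 /=; case: (lead_state q) => [[]].
by rewrite (negbTE nabs) addnS.
Qed.

(** * Truncation of runs of [e] *)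

Section Truncation.
Variable M : nat.

Definition e_run (w : word) : nat := find (predC1 gen_e) w.

Definition push (g : generator) (w : word) : word :=
  if (g == gen_e) && (M <= e_run w) then w else g :: w.

Definition trunc (w : word) : word := foldr push [::] w.

Lemma trunc_cons g w : trunc (g :: w) = push g (trunc w). Proof. by []. Qed.

Lemma e_run_split w : w = nseq (e_run w) gen_e ++ drop (e_run w) w.
Proof.
rewrite -{1}(cat_take_drop (e_run w) w); congr (_ ++ _).
elim: w => [//|g w IH]; rewrite /e_run /=; case: eqP => [->|//] /=.
by congr (_ :: _).
Qed.

Lemma e_run_iter_push k w : minn k M <= e_run (iter k (push gen_e) w).
Proof.
elim: k => [|k IH]; first by rewrite min0n.
rewrite iterS {1}/push eqxx /=; case: ifP => [|_]; first by lia.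
by rewrite {1}/e_run /= -/(e_run _); lia.
Qed.

Lemma foldr_push_nseq k w : foldr push w (nseq k gen_e) = iter k (push gen_e) w.
Proof. by elim: k => //= k ->. Qed.

(** An [e] dropped from [u] stood before [M] others; these already make a run of length at least [M]
    in front of [z], so it would be dropped there as well. *)
Lemma foldr_push_trunc z u : foldr push z (trunc u) = foldr push z u.
Proof.
elim: u => [//|g u IH]; rewrite trunc_cons [in LHS]/push.
case: ifP => [/andP[/eqP-> Mu]|_] /=; last by rewrite IH.
rewrite -IH; set y := foldr push z (trunc u).
suff My : M <= e_run y by rewrite /push eqxx My.
rewrite /y [trunc u]e_run_split -(subnKC Mu) nseqD -catA foldr_cat.
rewrite foldr_push_nseq; apply: leq_trans (e_run_iter_push _ _).
by rewrite minnn.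
Qed.

Lemma trunc_cat_congr u u' v v' : trunc u = trunc u' -> trunc v = trunc v' ->
  trunc (u ++ v) = trunc (u' ++ v').
Proof.
rewrite /trunc !foldr_cat => uu' ->.
by rewrite -foldr_push_trunc /trunc uu' foldr_push_trunc.
Qed.

Lemma count_trunc w : count (predC1 gen_e) (trunc w) = count (predC1 gen_e) w.
Proof.
elim: w => [//|g w IH]; rewrite trunc_cons /push /= -IH.
by case: ifP => [/andP[/eqP-> _]|].
Qed.

Lemma size_trunc w : size (trunc w) <= M + M.+1 * count (predC1 gen_e) w.
Proof.
(* The leading run is kept apart: a letter other than [e] turns it into an inner run, of length at
   most [M]. *)
suff [] : size (trunc w) <= e_run (trunc w) + M.+1 * count (predC1 gen_e) w /\
  e_run (trunc w) <= M by lia.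
elim: w => [//|g w]; rewrite trunc_cons /push /= mulnDr.
move: (M.+1 * count _ _) => k [IH1 IH2]; case: eqP => [->|/eqP ne] /=.
  rewrite muln0 add0n; case: (leqP M (e_run _)) => lt; first by split.
  by rewrite /e_run /= -/(e_run _); lia.
by rewrite /e_run /= ne; lia.
Qed.

Lemma trunc_id w : size w <= M -> trunc w = w.
Proof.
elim: w => [//|g w IH] sw; rewrite trunc_cons IH; last exact: ltnW.
rewrite /push; case: ifP => // /andP[_ Me].
by move: sw; rewrite ltnNge (leq_trans Me (find_size _ _)).
Qed.

Lemma foldr_push_cat (g : generator) (p z : word) : g != gen_e ->
  foldr push (g :: z) p = foldr push [:: g] p ++ z /\
  has (predC1 gen_e) (foldr push [:: g] p).
Proof.
move=> ge; elim: p => [|h p [IH hs]] /=; first by rewrite ge.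
rewrite IH /push /e_run find_cat hs.
by case: ifP => //= _; rewrite hs orbT.
Qed.

(** An [e] is dropped only before a run of length at least [M]. The counter stays below [M], so
    [eqv_absorb_many] shows that what follows the run absorbs [e]. *)
Lemma eqv_push_nseq i z :
  (lead_state z).1.2 + i < M ->
  eqv (foldr push z (nseq i gen_e)) (nseq i gen_e ++ z).
Proof.
elim: i => [|i IH] lt /=; first exact: eqv_refl.
have {}IH := IH ltac:(lia).
apply: eqv_trans (eqv_cat2l [:: gen_e] IH).
set y := foldr _ _ _ in IH *; rewrite {1}/push eqxx /=.
case: leqP => [My|_]; last exact: eqv_refl.
apply/eqv_sym; rewrite [y]e_run_split; set q := drop _ _.
have abs : eqv (gen_e :: q) q.
  apply: (@eqv_absorb_many (e_run y) q y).
    by rewrite -e_run_split; apply: eqv_refl.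
  by rewrite (lead_state_eqv IH); have := lead_state_nseq_e i z; lia.
rewrite (_ : gen_e :: _ = nseq (e_run y) gen_e ++ gen_e :: q).
  exact: eqv_cat2l.
by elim: (e_run y) => //= k ->.
Qed.

End Truncation.

(** * Outer blocks and letter counts *)

Definition pre (P : pred generator) (w : word) : nat :=
  count P (take (index gen_x w) w).

Lemma pre_cat P u v :
  pre P (u ++ v) = if gen_x \in u then pre P u else pre P u + pre P v.
Proof.
rewrite /pre index_cat; case: ifP => xu; rewrite take_cat.
  by move: xu; rewrite -index_mem => ->.
by rewrite ltnNge leq_addr addKn count_cat (memNindex (negbT xu)) take_size.
Qed.

Lemma pre_notin P w : gen_x \notin w -> pre P w = count P w.
Proof. by move=> xw; rewrite /pre memNindex // take_size. Qed.

Lemma pre_size P w : pre P w <= size w.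
Proof.
apply: leq_trans (count_size _ _) _.
by rewrite size_take; case: ltnP => // /ltnW.
Qed.

Definition first_a := pre (pred1 gen_a).
(** Letters [e] are counted too because xca = xe trades an [a] for an [e]. *)
Definition last_ae (w : word) := pre (pred2 gen_a gen_e) (rev w).

Lemma last_ae_cat u v :
  last_ae (u ++ v) = if gen_x \in v then last_ae v else last_ae v + last_ae u.
Proof. by rewrite /last_ae rev_cat pre_cat mem_rev. Qed.

Lemma mem_count_x (w : word) : (gen_x \in w) = (0 < count_mem gen_x w).
Proof. by rewrite -has_count has_pred1. Qed.

(** The last equality is the invariance of #a - #b - #c, written without subtraction. *)
Lemma gen_cong_invariants (u v : freeSemigroup generator) :
  gen_cong S_rels u v ->
  [/\ count_mem gen_x u = count_mem gen_x v,
      first_a u = first_a v, last_ae u = last_ae v &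
      count_mem gen_a u + count (pred2 gen_b gen_c) v =
      count_mem gen_a v + count (pred2 gen_b gen_c) u].
Proof.
elim=> {u v} [u v|//|u v _ [-> -> -> ->]//|
  v u w _ [-> -> -> e1] _ [-> -> -> e2]|
  w u v _ [e1 e2 e3 e4]|w u v _ [e1 e2 e3 e4]].
- rewrite !inE.
  by case/or4P=> [/eqP[-> ->]|/eqP[-> ->]|/eqP[-> ->]|/or3P[]/eqP[-> ->]].
- by split=> //; lia.
- rewrite /= /first_a !pre_cat !last_ae_cat -!/first_a !count_cat e1 e2 e3.
  by rewrite !mem_count_x e1; split=> //; rewrite addnACA e4 addnACA.
- rewrite /= /first_a !pre_cat !last_ae_cat -!/first_a !count_cat e1 e2 e3.
  by rewrite !mem_count_x e1; split=> //; rewrite addnACA e4 addnACA.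
Qed.

Lemma split_last_e (u : word) : exists s i,
  u = s ++ nseq i gen_e /\
  (s = [::] \/ exists p g, g != gen_e /\ s = rcons p g).
Proof.
elim/last_ind: u => [|u g [s [i [-> e]]]].
  by exists [::], 0; split=> //; left.
case: (eqVneq g gen_e) => [->|ge].
  exists s, i.+1; split=> //; rewrite rcons_cat -cats1.
  by rewrite -[[:: gen_e]]/(nseq 1 gen_e) -nseqD addn1.
exists (rcons (s ++ nseq i gen_e) g), 0; rewrite cats0; split=> //; right.
by exists (s ++ nseq i gen_e), g.
Qed.

(** The last letter of [u] other than [e] shields what precedes it, so only the final run of [e] in
    [u] meets [v]. That run lies after the last [x], so its length is at most [last_ae u]. *)
Lemma eqv_trunc_cat M u v :
  eqv (trunc M u) u -> eqv (trunc M v) v ->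
  (lead_state v).1.2 + last_ae u < M ->
  eqv (trunc M (u ++ v)) (u ++ v).
Proof.
move=> eu ev lt; have [s [i [us s_e]]] := split_last_e u.
have [s' s'E] : exists s', forall z,
    foldr (push M) z u = s' ++ foldr (push M) z (nseq i gen_e).
  case: s_e => [s0|[p [g [ge se]]]]; rewrite us.
    by exists [::] => z; rewrite s0.
  exists (foldr (push M) [:: g] p) => z.
  have pg y : push M g y = g :: y by rewrite /push (negbTE ge).
  rewrite se cat_rcons foldr_cat /= pg.
  by have [-> _] := foldr_push_cat M p (foldr (push M) z (nseq i gen_e)) ge.
have i_le : i <= last_ae u.
  rewrite us last_ae_cat mem_nseq andbF /last_ae rev_nseq pre_notin; last first.
    by rewrite mem_nseq andbF.
  by rewrite count_nseq /= mul1n; lia.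
have eu' : eqv (s' ++ nseq i gen_e) u.
  apply: eqv_trans eu; rewrite /trunc s'E.
  rewrite -/(trunc M _) trunc_id ?size_nseq; [exact: eqv_refl | lia].
rewrite {1}/trunc foldr_cat s'E -/(trunc M v).
apply: eqv_trans (eqv_cat2l u ev).
apply: eqv_trans (eqv_cat2r _ eu').
rewrite -catA; apply/eqv_cat2l/eqv_push_nseq.
by rewrite (lead_state_eqv ev); lia.
Qed.

(** * Wrapping a given finite set *)

Lemma count_non_e (w : word) : count (predC1 gen_e) w =
  count_mem gen_a w + count (pred2 gen_b gen_c) w + count_mem gen_x w.
Proof. by elim: w => [//|g w /= ->]; case: g; rewrite /=; lia. Qed.

Theorem proposition15 : LWF S_pres.
Proof.
move=> H.
pose f (u : freeSemigroup generator) : S_pres := \pi_(presented S_rels) u.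
have fE u v : f u = f v <-> eqv u v.
  by split=> [/presented_eqP/eqv_letters|/eqv_letters/presented_eqP].
pose rp (h : S_pres) : freeSemigroup generator := repr h.
have rpK h : f (rp h) = h by exact: reprK.
have [N NH] : exists N, forall h, h \in H -> size (rp h) <= N.
  exists (\max_(h <- H) size (rp h)) => h hH.
  exact: (@leq_bigmax_seq _ _ xpredT (fun h => size (rp h))).
(* Just above the sum of [last_ae u] and the [e]-counter of [v], each at most [N] for values in
   [H]. *)
pose M := (2 * N).+1.
have inH u : f u \in H -> [/\ first_a u <= N, last_ae u <= N,
    (lead_state u).1.2 <= N,
    count_mem gen_x u <= N &
    count (pred2 gen_b gen_c) u <= count_mem gen_a u + N].
  move=> /[dup] /NH; have /presented_eqP e := rpK (f u).
  have [<- <- <- bal] := gen_cong_invariants e.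
  move: e => /eqv_letters/lead_state_eqv <- szN _.
  split.
  - exact: leq_trans (pre_size _ _) szN.
  - by apply: leq_trans (pre_size _ _) _; rewrite size_rev.
  - exact: leq_trans (lead_state_size _) szN.
  - exact: leq_trans (count_size _ _) szN.
  - apply: leq_trans (leq_addl (count_mem gen_a (rp (f u))) _) _.
    by rewrite bal leq_add2l (leq_trans (count_size _ _)).
(* Concatenation creates an inner block with at most [2 * N] letters [a], which
   the summand [2 * N] pays for; the factor [3 * N] leaves room for the [a]'s of
   the representatives, of length at most [N]. *)
pose good (u : freeSemigroup generator) :=
  [/\ f u \in H, eqv (trunc M u) u &
      (count_mem gen_x u == 0) || (count_mem gen_a u + 2 * N <=
         first_a u + last_ae u + 3 * N * count_mem gen_x u)].
have good_trunc u v : good u -> good v -> eqv (trunc M (u ++ v)) (u ++ v).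
  move=> [uH eu _] [vH ev _]; apply: eqv_trunc_cat => //.
  have [_ ? _ _ _] := inH _ uH; have [_ _ ? _ _] := inH _ vH.
  by rewrite /M; lia.
(* [K] bounds the letters [a] of a good word, [K + N] its letters [b] and [c], and [N] its letters
   [x]. *)
pose K := 2 * N + 3 * N * N.
pose L := K + (K + N) + N.
have good_count u : good u -> count (predC1 gen_e) u <= L.
  move=> [uH _ ua]; have [? ? _ ? ?] := inH _ uH.
  suff : count_mem gen_a u <= K by rewrite count_non_e /L; lia.
  case/orP: ua => [x0|].
    move: x0; rewrite eqn0Ngt -mem_count_x => xu.
    by rewrite -(pre_notin (pred1 gen_a) xu) -/first_a /K; lia.
  have : 3 * N * count_mem gen_x u <= 3 * N * N by apply: leq_mul.
  by rewrite /K; lia.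
pose B := M + M.+1 * (2 * L).
(* Words with more than [2 * L] letters other than [e] form an ideal, collapsed to [None]; tracked
   words stay outside it. *)
pose phi (u : freeSemigroup generator) : option {bseq B of generator} :=
  if count (predC1 gen_e) u <= 2 * L then Some (insub_bseq B (trunc M u))
  else None.
have phiE (u v : freeSemigroup generator) :
    count (predC1 gen_e) u <= 2 * L -> phi u = phi v ->
    trunc M u = trunc M v.
  move=> ku; rewrite /phi ku; case: ifP => // kv [].
  have szB (w : word) :
      count (predC1 gen_e) w <= 2 * L -> size (trunc M w) <= B.
    move=> kw; apply: leq_trans (size_trunc _ _) _.
    by rewrite leq_add2l leq_mul2l kw orbT.
  move=> /(congr1 val); rewrite /insub_bseq /insubd.
  by rewrite !insubT ?szB.
(* The value of a^(N+1) is outside [H], since its [first_a] exceeds [N]. *)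
apply: (@LWF_at_of_finite_index _ _ f _ phi H good
  (f (@Word _ (nseq N.+1 gen_a) isT))).
- by move=> u v; apply: presented_pi_mul.
- move=> u u' v v' eu ev.
  have count_phi (w w' : freeSemigroup generator) :
      phi w = phi w' -> count (predC1 gen_e) w <= 2 * L ->
      count (predC1 gen_e) w' = count (predC1 gen_e) w.
    by move=> e /phiE/(_ e) e'; rewrite -(count_trunc M w) e' count_trunc.
  have half w w' z z' : phi w = phi w' -> phi z = phi z' ->
      count (predC1 gen_e) (w * z)%g <= 2 * L ->
      phi (w * z)%g = phi (w' * z')%g.
    move=> ew ez kwz; rewrite /phi kwz; move: kwz; rewrite /= !count_cat => kwz.
    have kw := leq_trans (leq_addr _ _) kwz.
    have kz := leq_trans (leq_addl _ _) kwz.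
    rewrite (count_phi _ _ ew kw) (count_phi _ _ ez kz) kwz.
    by rewrite (trunc_cat_congr (phiE _ _ kw ew) (phiE _ _ kz ez)).
  case: (leqP (count (predC1 gen_e) (u * v)%g) (2 * L)) => [|kuv].
    exact: half.
  case: (leqP (count (predC1 gen_e) (u' * v')%g) (2 * L)) => [k'|kuv'].
    exact/esym/half.
  by rewrite /phi leqNgt kuv leqNgt kuv'.
- apply/negP => /inH[+ _ _ _ _]; rewrite /first_a pre_notin ?mem_nseq //=.
  by rewrite count_nseq /=; lia.
- move=> h hH; exists (rp h); last exact: rpK.
  have sz := NH h hH.
  split; first by rewrite rpK.
    rewrite trunc_id; [exact: eqv_refl | rewrite /M mul2n -addnn].
    exact: leq_trans sz (leqW (leq_addr _ _)).
  case: eqVneq => [//|]; rewrite -lt0n => x_gt0 /=.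
  apply: leq_trans (leq_addl _ _).
  apply: leq_trans (leq_mul (leqnn (3 * N)) x_gt0).
  rewrite muln1 -[3]/(1 + 2) mulnDl mul1n leq_add2r.
  exact: leq_trans (count_size _ _) sz.
- move=> u v gu gv uvH; split=> //; first exact: good_trunc.
  case: gu => uH _ bu; case: gv => vH _ bv.
  have [? ? _ _ _] := inH _ uH; have [? ? _ _ _] := inH _ vH.
  (* A factor without [x] joins an outer block of the product, whose count pays for all its letters
     [a]. *)
  have first_a0 (w : word) :
      count_mem gen_x w = 0 -> first_a w = count_mem gen_a w.
    by move=> /eqP; rewrite eqn0Ngt -mem_count_x; apply: pre_notin.
  have last_ae0 (w : word) :
      count_mem gen_x w = 0 -> count_mem gen_a w <= last_ae w.
    move=> /eqP; rewrite eqn0Ngt -mem_count_x => xw.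
    rewrite /last_ae pre_notin ?mem_rev // count_rev.
    by apply: sub_count => g /= ->.
  move: (first_a0 u) (last_ae0 v) bu bv.
  rewrite /= /first_a pre_cat last_ae_cat -/first_a !count_cat mulnDr.
  rewrite !mem_count_x.
  move: (count_mem gen_x u) (count_mem gen_x v) => xu xv.
  move: (count_mem gen_a u) (count_mem gen_a v) => au av.
  rewrite addn_eq0; case: xu => [|xu]; case: xv => [|xv] //=; lia.
- have tracked_count u : good u \/ (exists u1 u2 : freeSemigroup generator,
      [/\ good u1, good u2 & u = (u1 * u2)%g]) ->
      eqv (trunc M u) u /\ count (predC1 gen_e) u <= 2 * L.
    case=> [gu|[u1 [u2 [g1 g2 ->]]]].
      by have := good_count _ gu; case: gu => _ ? _; split=> //; lia.
    split; first exact: good_trunc.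
    have := good_count _ g1; have := good_count _ g2.
    by rewrite /= count_cat; lia.
  move=> u v /tracked_count[eu ku] /tracked_count[ev _] /(phiE _ _ ku) e.
  by apply/fE; apply: eqv_trans (eqv_sym eu) _; rewrite e.
Qed.
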